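(* Let $\mathcal{P}=\langle P,A,I,G\rangle$ be a temporal planning problem, fix $\epsilon\ge 0$, and let $\mathcal{N}$ be the network of timed automata encoding $\mathcal{P}$ described in the context. Let $\pi$ be a plan such that $\mathit{valid}(\pi)$ and $\mathit{no\_self\_overlap}(\pi)$ hold. Then $\mathcal{N}\vDash EF(\mathit{loc}(\mathcal{A}_M)=\mathit{goal}_M)$; that is, there is a finite run of $\mathcal{N}$ starting in its initial configuration that reaches a configuration in which the main automaton $\mathcal{A}_M$ is in location $\mathit{goal}_M$.
   Context: **Temporal planning.** A snap action $h=\langle \mathit{pres}(h),\mathit{adds}(h),\mathit{dels}(h)\rangle$ consists of three subsets of a finite set of propositions $P$. A durative action $a$ consists of: - a start snap action $a_\vdash$ and an end snap action $a_\dashv$; - a set $\mathit{over\_all}(a)\subseteq P$ of invariants; - a lower bound $L(a)=\langle l_a,\triangleleft_1\rangle$ and an upper bound $U(a)=\langle\triangleleft_2,u_a\rangle$, with $l_a,u_a\in\mathbb{Q}$ and $\triangleleft_1,\triangleleft_2\in\{<,\le\}$. A duration $d\in\mathbb{Q}$ satisfies $\mathit{dur\_c\_sat}(a,d)$ iff $l_a\triangleleft_1 d$ and $d\triangleleft_2 u_a$. A temporal planning problem $\mathcal{P}=\langle P,A,I,G\rangle$ consists of: - a finite set of propositions $P$; - a finite set of durative actions $A=\{a_1,\dots,a_N\}$; - an initial state $I\subseteq P$; - a goal $G\subseteq P$. A state is a subset of $P$. **Plans.** A plan $\pi=[\langle\alpha_1,t_1,d_1\rangle,\dots,\langle\alpha_n,t_n,d_n\rangle]$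 is a list with $\alpha_i\in A$ and $t_i,d_i\in\mathbb{Q}$. - Its induced parallel plan $H(\pi)$ is the set of all pairs $\langle t_i,(\alpha_i)_\vdash\rangle$ and $\langle t_i+d_i,(\alpha_i)_\dashv\rangle$. - Its happening time point sequence $\mathit{htps}(\pi)=\{\tau_0<\dots<\tau_k\}$ is the set of time points occurring in $H(\pi)$, listed in increasing order. - $\mathit{Adds}(t)$ (resp. $\mathit{Dels}(t)$) is the union of $\mathit{adds}(h)$ (resp. $\mathit{dels}(h)$) over all $\langle t,h\rangle\in H(\pi)$. - $\mathit{Invs}(t)$ is the union of $\mathit{over\_all}(a)$ over all $\langle a,t',d\rangle\in\pi$ with $t'<t\le t'+d$. A state sequence $[M_0,\dots,M_m]$ is valid w.r.t. $\pi$ if for every $\tau_i\in\mathit{htps}(\pi)$: - $\mathit{pres}(h)\subseteq M_i$ for every $\langle\tau_i,h\rangle\in H(\pi)$; - $M_{i+1}=(M_i\setminus\mathit{Dels}(\tau_i))\cup\mathit{Adds}(\tau_i)$; - $\mathit{Invs}(\tau_i)\subseteq M_i$. Two snap actions are mutex, written $\mathrm{mutex}(a,b)$, if $\mathit{pres}(a)\cap(\mathit{adds}(b)\cup\mathit{dels}(b))\ne\emptyset$ or $\mathit{adds}(a)\cap\mathit{dels}(b)\neq\emptyset$. $\mathit{valid}(\pi)$ holds iff all of the following hold: 1. There is a valid state sequence $[M_0,\dots,M_m]$ for $\pi$ with $M_0=I$ and $G\subseteq M_m$. 2. $\mathit{dur\_c\_sat}(\alpha_i,d_i)$ and $0\le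 d_i$ hold for all $i$. 3. Whenever $\langle s,a\rangle,\langle t,b\rangle\in H(\pi)$, $a\ne b$ and $\mathrm{mutex}(a,b)$, we have $0<|t-s|$ and $\epsilon\le|t-s|$. $\mathit{no\_self\_overlap}(\pi)$ holds iff for all distinct entries $\langle\alpha_i,t_i,d_i\rangle,\langle\alpha_j,t_j,d_j\rangle$ of $\pi$ with $t_i\le t_j\le t_i+d_i$ we have $\alpha_i\ne\alpha_j$. **Networks of timed automata.** A timed automaton has: - a set of locations, an initial location, and a set of urgent locations; - rational-valued clocks $\mathcal{X}$ and integer variables $\mathcal{V}$; - edges $\langle l,b,g,u,r,l'\rangle$, where $b$ is a conjunction of comparisons of arithmetic expressions over the variables, $g$ is a set of clock constraints $x\bowtie d$ ($d\in\mathbb{Q}$, $\bowtie\in\{<,\le,=,\ge,>\}$), $u$ is a set of variable updates $z:=e$ (at most one per variable), and $r\subseteq\mathcal{X}$ is a set of clocks to reset. A network is a list of automata sharing variables and clocks. A configuration $\langle L,v,c\rangle$ consists of a list $L$ of current locations (one per automaton), a variable assignment $v$, and a clock valuation $c$. There are two kinds of transitions: - A delay transition $\langle L,v,c\rangle\to\langle L,v,c+\delta\rangle$, for $\delta\ge0$, is allowed iff no location in $L$ is urgent; it adds $\delta$ to every clock. - An internal transition uses an edge $\langle l,b,g,u,r,l'\rangle$ of some automaton $i$ with $L_i=l$, $v\models b$ and $c\models g$. It sets $L_i:=l'$, performs all updates simultaneously (each right-hand side is evaluated in $v$), and resets the clocks in $r$ to $0$. A run is a finite sequence of such transitions. **The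 encoding $\mathcal{N}$.** *Variables.* - $vp_p$ and $lp_p$ for each $p\in P$; - $aa$ (the number of active actions); - $ps$ (the planning stage: $0$ not started, $1$ planning, $2$ done). *Clocks.* $ca_\vdash$ and $ca_\dashv$ for each $a\in A$. For a snap action $h$, $ch$ denotes its clock: $ch=ca_\vdash$ if $h=a_\vdash$ and $ch=ca_\dashv$ if $h=a_\dashv$. *Main automaton $\mathcal{A}_M$.* Its locations are $\mathit{init}_M$ (initial, urgent), $\mathit{plan}_M$ and $\mathit{goal}_M$. Its edges are: - $e_{1M}$ from $\mathit{init}_M$ to $\mathit{plan}_M$: no condition; updates $ps:=1$ and $vp_p:=1$ for $p\in I$. - $e_{2M}$ from $\mathit{plan}_M$ to $\mathit{goal}_M$: condition $aa=0$ and $vp_p=1$ for all $p\in G$; update $ps:=2$. - An unconditional self-loop at $\mathit{goal}_M$. *Auxiliary formulas for a snap action $b$.* - $\mathit{mutex\_guards}(b)$ is the set of guards $0<ch$ and $\epsilon\le ch$, for every snap action $h$ of the problem with $\mathrm{mutex}(b,h)$. - $\mathit{pre\_sat}(b)$ is $\bigwedge_{p\in\mathit{pres}(b)}vp_p=1$. - $\mathit{eff\_sat\_invs}(b)$ is $\bigwedge_{p\in\mathit{dels}(b)\setminus\mathit{adds}(b)}lp_p=0$. - $\mathit{prop\_effs}(b)$ consists of $vp_p:=0$ for $p\in\mathit{dels}(b)\setminus\mathit{adds}(b)$ and $vp_p:=1$ for $p\in\mathit{adds}(b)$. For a durative action $a$, $\mathit{sat\_dur\_bounds}(a)$ is $\{l_a\triangleleft_1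 ca_\vdash,\ ca_\vdash\triangleleft_2 u_a\}$. *Action automaton $\mathcal{A}_a$ (one for each $a\in A$).* Its locations are $\mathit{inactive}$ (initial), $\mathit{starting}$ (urgent), $\mathit{running}$ and $\mathit{ending}$ (urgent). Every edge additionally has the condition $ps=1$. The edges are: - $se_a$ from $\mathit{inactive}$ to $\mathit{starting}$: condition $\mathit{pre\_sat}(a_\vdash)\wedge\mathit{eff\_sat\_invs}(a_\vdash)$; guard $\mathit{mutex\_guards}(a_\vdash)$; updates $\mathit{prop\_effs}(a_\vdash)\cup\{aa:=aa+1\}$; reset $\{ca_\vdash\}$. - $se'_a$ from $\mathit{starting}$ to $\mathit{running}$: condition $vp_p=1$ for $p\in\mathit{over\_all}(a)$; updates $lp_p:=lp_p+1$ for $p\in\mathit{over\_all}(a)$. - $ee_a$ from $\mathit{running}$ to $\mathit{ending}$: guard $\mathit{mutex\_guards}(a_\vdash)\cup\mathit{sat\_dur\_bounds}(a)$; updates $lp_p:=lp_p-1$ for $p\in\mathit{over\_all}(a)$; reset $\{ca_\dashv\}$. - $ee'_a$ from $\mathit{ending}$ to $\mathit{inactive}$: condition $\mathit{pre\_sat}(a_\dashv)\wedge\mathit{eff\_sat\_invs}(a_\dashv)$; updates $\mathit{prop\_effs}(a_\dashv)\cup\{aa:=aa-1\}$. - $ie_a$ from $\mathit{starting}$ to $\mathit{ending}$: guard $\mathit{mutex\_guards}(a_\dashv)\cup\mathit{sat\_dur\_bounds}(a)$; reset $\{ca_\dashv\}$. *Network and initial configuration.* The network is $\mathcal{N}=[\mathcal{A}_M,\mathcal{A}_{a_1},\dots,\mathcal{A}_{a_N}]$.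 In the initial configuration the locations are $[\mathit{init}_M,\mathit{inactive},\dots,\mathit{inactive}]$, and all variables and all clocks are $0$.
   Formalization: Two formulas of the encoding are corrected, as the literal claim is false: the guard of ee_a uses mutex_guards(a_⊣) instead of mutex_guards(a_⊢), and mutex holds only between different snap actions (told apart by name), so no snap action's guards constrain its own clock. *)

(* Defs.v *)
From Stdlib Require List.
From HB Require Import structures.
From mathcomp Require Import all_boot all_order all_algebra.

Set Implicit Arguments.
Unset Strict Implicit.
Unset Printing Implicit Defensive.

Import Order.TTheory GRing.Theory Num.Theory.
Local Open Scope ring_scope.

Section Planning.

Record snap_data (P : finType) := SnapData {
  sd_pres : {set P};
  sd_adds : {set P};
  sd_dels : {set P} }.

Inductive strictness := Strict | Weak.

Definition ineq (s : strictness) (x y : rat) : bool :=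
  if s is Strict then x < y else x <= y.

Record durative_action (P : finType) := DurativeAction {
  da_start : snap_data P;
  da_end : snap_data P;
  da_over_all : {set P};
  da_lower : rat * strictness;
  da_upper : strictness * rat }.

(* The finite type [A] names the actions; [pb_act] gives their contents. *)
Record problem (P A : finType) := Problem {
  pb_act : A -> durative_action P;
  pb_init : {set P};
  pb_goal : {set P} }.

Variables (P A : finType) (Pb : problem P A).

(* A snap action is identified with its name, "start of a" or "end of a", so
   that snap actions of different provenance are different (and own different
   clocks) even when their contents coincide. *)
Definition snap : finType := (A + A)%type.
Definition at_start (a : A) : snap := inl a.
Definition at_end (a : A) : snap := inr a.

Definition snap_contents (h : snap) : snap_data P :=
  match h with
  | inl a => da_start (pb_act Pb a)
  | inr a => da_end (pb_act Pb a)
  end.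

Definition pres (h : snap) := sd_pres (snap_contents h).
Definition adds (h : snap) := sd_adds (snap_contents h).
Definition dels (h : snap) := sd_dels (snap_contents h).
Definition over_all (a : A) := da_over_all (pb_act Pb a).

Definition dur_c_sat (a : A) (d : rat) : bool :=
  ineq (da_lower (pb_act Pb a)).2 (da_lower (pb_act Pb a)).1 d &&
  ineq (da_upper (pb_act Pb a)).1 d (da_upper (pb_act Pb a)).2.

(* Being mutex is a relation between two different snap actions. If a snap
   action could be mutex with itself, the guards of the encoding would force
   its occurrences to be [eps] apart, which the validity of a plan does not. *)
Definition mutex (a b : snap) : bool :=
  (a != b) &&
  ((pres a :&: (adds b :|: dels b) != set0) || (adds a :&: dels b != set0)).

Record entry := Entry { e_act : A; e_time : rat; e_dur : rat }.
Definition plan := seq entry.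

Definition happenings (pi : plan) : seq (rat * snap) :=
  [seq (e_time e, at_start (e_act e)) | e <- pi] ++
  [seq (e_time e + e_dur e, at_end (e_act e)) | e <- pi].

Definition htps (pi : plan) : seq rat :=
  sort <=%R (undup [seq x.1 | x <- happenings pi]).

Definition Adds (pi : plan) (t : rat) : {set P} :=
  \bigcup_(x <- happenings pi | x.1 == t) adds x.2.
Definition Dels (pi : plan) (t : rat) : {set P} :=
  \bigcup_(x <- happenings pi | x.1 == t) dels x.2.
Definition Invs (pi : plan) (t : rat) : {set P} :=
  \bigcup_(e <- pi | (e_time e < t) && (t <= e_time e + e_dur e))
     over_all (e_act e).

(* The sequence ends with the state reached after the last happening time
   point: a longer sequence would have an unconstrained last state. *)
Definition valid_state_seq (pi : plan) (M : seq {set P}) : Prop :=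
  size M = (size (htps pi)).+1 /\
  forall i, (i < size (htps pi))%N ->
    let tau := nth 0 (htps pi) i in
    let Mi := nth set0 M i in
    [/\ forall h, (tau, h) \in happenings pi -> pres h \subset Mi,
        nth set0 M i.+1 = (Mi :\: Dels pi tau) :|: Adds pi tau
      & Invs pi tau \subset Mi].

Definition valid (eps : rat) (pi : plan) : Prop :=
  [/\ exists M, [/\ valid_state_seq pi M,
                    nth set0 M 0 = pb_init Pb
                  & pb_goal Pb \subset last set0 M],
      forall e, List.In e pi -> dur_c_sat (e_act e) (e_dur e) /\ 0 <= e_dur e
    & forall s t (a b : snap),
        (s, a) \in happenings pi -> (t, b) \in happenings pi ->
        a <> b -> mutex a b -> 0 < `|t - s| /\ eps <= `|t - s|].

Definition no_self_overlap (pi : plan) : Prop :=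
  forall i j x y, i <> j -> onth pi i = Some x -> onth pi j = Some y ->
    e_time x <= e_time y <= e_time x + e_dur x -> e_act x <> e_act y.

End Planning.

Section TimedAutomata.

Inductive cmp_op := CLt | CLe | CEq | CGe | CGt.

Definition cmp (R : numDomainType) (o : cmp_op) (x y : R) : bool :=
  match o with
  | CLt => x < y
  | CLe => x <= y
  | CEq => x == y
  | CGe => y <= x
  | CGt => y < x
  end.

Variables (Loc : eqType) (V : Type) (X : finType).

Inductive expr :=
  | EConst of int
  | EVar of V
  | EAdd of expr & expr
  | ESub of expr & expr
  | EMul of expr & expr.

Fixpoint eval (v : V -> int) (e : expr) : int :=
  match e with
  | EConst n => n
  | EVar z => v z
  | EAdd e1 e2 => eval v e1 + eval v e2
  | ESub e1 e2 => eval v e1 - eval v e2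
  | EMul e1 e2 => eval v e1 * eval v e2
  end.

Definition condition := seq (expr * cmp_op * expr).
Definition sat_cond (v : V -> int) (b : condition) : bool :=
  all (fun k => cmp k.1.2 (eval v k.1.1) (eval v k.2)) b.

Definition guard := seq (X * cmp_op * rat).
Definition sat_guard (c : X -> rat) (g : guard) : bool :=
  all (fun k => cmp k.1.2 (c k.1.1) k.2) g.

(* [u z = Some e] means that the update z := e is in the set; a partial map
   holds at most one update per variable. *)
Definition updates := V -> option expr.
Definition apply_updates (u : updates) (v : V -> int) : V -> int :=
  fun z => if u z is Some e then eval v e else v z.

Definition apply_resets (r : {set X}) (c : X -> rat) : X -> rat :=
  fun x => if x \in r then 0 else c x.

Record edge := Edge {
  src : Loc;
  ed_cond : condition;
  ed_guard : guard;
  ed_upd : updates;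
  ed_reset : {set X};
  tgt : Loc }.

Record automaton := Automaton {
  ta_locs : seq Loc;
  ta_init : Loc;
  ta_urgent : seq Loc;
  ta_edges : seq edge }.

Definition network := seq automaton.

Record config := Config {
  cf_locs : seq Loc;
  cf_vars : V -> int;
  cf_clocks : X -> rat }.

Inductive step (N : network) : config -> config -> Prop :=
  | step_delay L v c delta :
      0 <= delta ->
      (forall i T l, onth N i = Some T -> onth L i = Some l ->
         l \notin ta_urgent T) ->
      step N (Config L v c) (Config L v (fun x => c x + delta))
  | step_internal L v c i T e :
      onth N i = Some T -> List.In e (ta_edges T) -> onth L i = Some (src e) ->
      sat_cond v (ed_cond e) -> sat_guard c (ed_guard e) ->
      step N (Config L v c)
        (Config (set_nth (src e) L i (tgt e))
                (apply_updates (ed_upd e) v) (apply_resets (ed_reset e) c)).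

Inductive run (N : network) : config -> config -> Prop :=
  | run_nil s : run N s s
  | run_cons s1 s2 s3 : step N s1 s2 -> run N s2 s3 -> run N s1 s3.

Definition initial_config (N : network) : config :=
  Config [seq ta_init T | T <- N] (fun _ => 0) (fun _ => 0).

Definition EF (N : network) (phi : config -> Prop) : Prop :=
  exists s, run N (initial_config N) s /\ phi s.

End TimedAutomata.

Inductive location :=
  | init_M | plan_M | goal_M
  | inactive | starting | running | ending.

Definition location_code (l : location) : nat :=
  match l with
  | init_M => 0 | plan_M => 1 | goal_M => 2
  | inactive => 3 | starting => 4 | running => 5 | ending => 6
  end.
Definition location_decode (n : nat) : location :=
  nth init_M [:: init_M; plan_M; goal_M; inactive; starting; running; ending] n.
Lemma location_codeK : cancel location_code location_decode.
Proof. by case. Qed.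
HB.instance Definition _ := Equality.copy location (can_type location_codeK).

Section Encoding.

Variables (P A : finType) (Pb : problem P A) (eps : rat).

Inductive var := VP of P | LP of P | AA | PS.

(* A snap action serves as its own clock: [at_start a] and [at_end a] are the
   clocks of the start and of the end of [a]. *)
Local Notation clock := (snap A).
Local Notation condition := (condition var).
Local Notation guard := (guard clock).
Local Notation updates := (updates var).
Local Notation edge := (edge location var clock).
Local Notation automaton := (automaton location var clock).

Definition var_is (z : var) (n : int) : expr var * cmp_op * expr var :=
  (EVar z, CEq, EConst var n).
Definition var_incr (z : var) : expr var := EAdd (EVar z) (EConst var 1).
Definition var_decr (z : var) : expr var := ESub (EVar z) (EConst var 1).

Definition no_updates : updates := fun _ => None.

Definition mutex_guards (b : snap A) : guard :=
  flatten [seq [:: (h, CGt, 0); (h, CGe, eps)]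
          | h <- enum [pred h | mutex Pb b h]].

Definition pre_sat (b : snap A) : condition :=
  [seq var_is (VP p) 1 | p <- enum (pres Pb b)].

Definition eff_sat_invs (b : snap A) : condition :=
  [seq var_is (LP p) 0 | p <- enum (dels Pb b :\: adds Pb b)].

Definition prop_effs (b : snap A) : updates := fun z =>
  if z is VP p then
    if p \in adds Pb b then Some (EConst var 1)
    else if p \in dels Pb b then Some (EConst var 0)
    else None
  else None.

Definition with_aa (e : expr var) (u : updates) : updates := fun z =>
  if z is AA then Some e else u z.

Definition update_lp (f : var -> expr var) (a : A) : updates := fun z =>
  if z is LP p then if p \in over_all Pb a then Some (f (LP p)) else None
  else None.

Definition sat_dur_bounds (a : A) : guard :=
  let: (l, s1) := da_lower (pb_act Pb a) in
  let: (s2, u) := da_upper (pb_act Pb a) in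
  [:: (at_start a, if s1 is Strict then CGt else CGe, l);
      (at_start a, if s2 is Strict then CLt else CLe, u)].

Definition e1M : edge :=
  Edge init_M [::] [::]
    (fun z => match z with
              | PS => Some (EConst var 1)
              | VP p => if p \in pb_init Pb then Some (EConst var 1) else None
              | _ => None
              end)
    set0 plan_M.

Definition e2M : edge :=
  Edge plan_M
    (var_is AA 0 :: [seq var_is (VP p) 1 | p <- enum (pb_goal Pb)]) [::]
    (fun z => if z is PS then Some (EConst var 2) else None)
    set0 goal_M.

Definition goal_loop : edge := Edge goal_M [::] [::] no_updates set0 goal_M.

Definition main_automaton : automaton :=
  Automaton [:: init_M; plan_M; goal_M] init_M [:: init_M]
    [:: e1M; e2M; goal_loop].

Definition planning : expr var * cmp_op * expr var := var_is PS 1.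

Definition se (a : A) : edge :=
  Edge inactive
    (planning :: pre_sat (at_start a) ++ eff_sat_invs (at_start a))
    (mutex_guards (at_start a))
    (with_aa (var_incr AA) (prop_effs (at_start a)))
    [set at_start a] starting.

Definition se' (a : A) : edge :=
  Edge starting
    (planning :: [seq var_is (VP p) 1 | p <- enum (over_all Pb a)])
    [::] (update_lp var_incr a) set0 running.

(* The mutex guards are those of the end snap action, which this edge performs
   (as does [ie]); with those of the start snap action, the encoding of a
   solvable problem may be unable to reach its goal. *)
Definition ee (a : A) : edge :=
  Edge running [:: planning]
    (mutex_guards (at_end a) ++ sat_dur_bounds a)
    (update_lp var_decr a) [set at_end a] ending.

Definition ee' (a : A) : edge :=
  Edge ending
    (planning :: pre_sat (at_end a) ++ eff_sat_invs (at_end a)) [::]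
    (with_aa (var_decr AA) (prop_effs (at_end a))) set0 inactive.

Definition ie (a : A) : edge :=
  Edge starting [:: planning]
    (mutex_guards (at_end a) ++ sat_dur_bounds a)
    no_updates [set at_end a] ending.

Definition action_automaton (a : A) : automaton :=
  Automaton [:: inactive; starting; running; ending] inactive
    [:: starting; ending] [:: se a; se' a; ee a; ee' a; ie a].

Definition encoding : network location var clock :=
  main_automaton :: [seq action_automaton a | a <- enum A].

End Encoding.

Definition main_in_goal (P A : finType)
    (s : config location (var P) (snap A)) : Prop :=
  onth (cf_locs s) 0 = Some goal_M.

(* Main.v *)
(** The main automaton leaves its initial location, [eps + 1] time units pass so
    that no mutex guard can fail because of the start of time, and then the run
    visits the happening time points of the plan, delaying in between. At a time
    point it takes, in this order, [ee] for the actions that end after a positive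
    duration, [se] for those that start, [ie] for those of duration zero, [ee']
    for all that end, and [se'] for those that start and go on. Thus the
    invariants of ending actions are released before, and those of starting
    actions acquired after, all effects of the time point. Simultaneous snap
    actions are pairwise not mutex, so every intermediate state satisfies the
    remaining preconditions, the order of the effects is irrelevant, and a
    proposition that is deleted and not added back cannot be an invariant of an
    action that goes on. *)

Require Import Defs.
From Stdlib Require List.
From HB Require Import structures.
From mathcomp Require Import all_boot all_order all_algebra.
From mathcomp Require Import lra.

Set Implicit Arguments.
Unset Strict Implicit.
Unset Printing Implicit Defensive.

Import Order.TTheory GRing.Theory Num.Theory.
Local Open Scope ring_scope.

Local Arguments sat_cond : simpl never.
Local Arguments sat_guard : simpl never.

(** * Runs extended at the end, and iteration over a finite set *)

Lemma run_rcons (Loc : eqType) (V : Type) (X : finType)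
    (N : network Loc V X) s1 s2 s3 :
  run N s1 s2 -> step N s2 s3 -> run N s1 s3.
Proof.
elim=> [s|r1 r2 r3 st _ IH] st'; first exact: run_cons st' (run_nil _ _).
exact: run_cons st (IH st').
Qed.

(** Lets the actions in [X] take the same kind of edge one by one, in an order that need not be
    known. *)
Lemma set_loop_ind (T : finType) (Q : {set T} -> Prop) (X : {set T}) :
  Q set0 ->
  (forall (Y : {set T}) a, Y \subset X -> a \in X -> a \notin Y ->
     Q Y -> Q (a |: Y)) ->
  Q X.
Proof.
move=> Q0 QS.
suff H n : (n <= #|X|)%N ->
    exists Y : {set T}, [/\ Y \subset X, #|Y| = n & Q Y].
  have [Y [sYX cY QY]] := H _ (leqnn _).
  suff <- : Y = X by [].
  by apply/eqP; rewrite eqEcard sYX cY leqnn.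
elim: n => [_|n IH ltnX]; first by exists set0; rewrite sub0set cards0.
have [Y [sYX cY QY]] := IH (ltnW ltnX).
have /properP[_ [a aX aY]] : Y \proper X by rewrite properEcard sYX cY.
exists (a |: Y); split; last exact: QS.
  by rewrite subUset sub1set aX.
by rewrite cardsU1 aY cY.
Qed.

(** * Configurations of the encoding and the invariant on its variables *)

Section Network.

Variables (P A : finType) (Pb : problem P A) (eps : rat).

Local Notation N := (encoding Pb eps).

Implicit Types (a : A) (h : snap A) (p : P) (M : {set P}).
Implicit Types (f : A -> location) (v : var P -> int) (c : snap A -> rat).

Definition conf (m : location) f v c : config location (var P) (snap A) :=
  Config (m :: [seq f a | a <- enum A]) v c.

Definition move_to f a l : A -> location := fun b => if b == a then l else f b.

Definition apply_snap M h : {set P} := (M :\: dels Pb h) :|: adds Pb h.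

(** During planning the variables are determined by the planning state [M] and the locations [f], so
    later arguments track only [M], [f] and the clocks. *)
Definition matches M f v : Prop :=
  [/\ v (PS P) = 1,
      v (AA P) = \sum_a (f a != inactive)%:R,
      forall p, v (LP p) =
                \sum_a ((f a == running) && (p \in over_all Pb a))%:R
    & forall p, v (VP p) = (p \in M)%:R].

(** Clocks are fixed only up to pointwise equality, so that resets and delays can be rearranged
    without functional extensionality. *)
Definition reachable M f c : Prop :=
  exists v c', [/\ run N (initial_config N) (conf plan_M f v c'),
                   matches M f v & c' =1 c].

Definition mutex_clear c b : Prop :=
  forall h, mutex Pb b h -> 0 < c h /\ eps <= c h.

(** Under [matches], this makes every counter tested by [eff_sat_invs] zero. *)
Definition lock_free f b : Prop :=
  forall p a, p \in dels Pb b -> p \notin adds Pb b -> f a = running ->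
    p \notin over_all Pb a.

(** Only the summand at [a] changes. [F] takes both location and action, so that one identity serves
    [aa] and the [lp] counters. *)
Lemma sum_move_to (F : location -> A -> int) f a l :
  \sum_b F (move_to f a l b) b = \sum_b F (f b) b - F (f a) a + F l a.
Proof.
rewrite (bigD1 a) //= [in RHS](bigD1 a) //= /move_to eqxx.
rewrite [X in _ = X + _]addrAC subrr add0r addrC; congr (_ + _).
by apply: eq_bigr => b /negPf->.
Qed.

Lemma matches_ext M f f' v : f =1 f' -> matches M f v -> matches M f' v.
Proof.
move=> eff [HPS HAA HLP HVP]; split=> // [|p].
  by rewrite HAA; apply: eq_bigr => a _; rewrite eff.
by rewrite HLP; apply: eq_bigr => a _; rewrite eff.
Qed.

Lemma reachable_ext M M' f f' c c' :
  M = M' -> f =1 f' -> c =1 c' -> reachable M f c -> reachable M' f' c'.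
Proof.
move=> <- eff ecc [v [c0 [Hr Hm Hc]]]; exists v, c0; split.
- by rewrite /conf -(eq_map eff).
- exact: matches_ext Hm.
- by move=> h; rewrite Hc ecc.
Qed.

Lemma sat_guard_ext (X : finType) (c c' : X -> rat) g :
  c =1 c' -> sat_guard c g = sat_guard c' g.
Proof. by move=> ecc; apply: eq_all => k; rewrite ecc. Qed.

Lemma sat_cond_is (z : P -> var P) n (B : {set P}) v :
  sat_cond v [seq var_is (z p) n | p <- enum B] <->
  {in B, forall p, v (z p) = n}.
Proof.
rewrite /sat_cond all_map; split=> [/allP H p pB|H].
  by apply/eqP/H; rewrite mem_enum.
by apply/allP=> p; rewrite mem_enum => /H /eqP.
Qed.

Lemma sat_guard_cat (X : finType) (c : X -> rat) g1 g2 :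
  sat_guard c (g1 ++ g2) = sat_guard c g1 && sat_guard c g2.
Proof. exact: all_cat. Qed.

Lemma sat_mutex_guards c b :
  mutex_clear c b -> sat_guard c (mutex_guards Pb eps b).
Proof.
move=> Hc; rewrite /sat_guard /mutex_guards.
have: all (mutex Pb b) (enum [pred h | mutex Pb b h]).
  by apply/allP=> h; rewrite mem_enum.
by elim: (enum _) => //= h s IH /andP[/Hc[-> ->]] /IH.
Qed.

Lemma sat_dur_boundsE c a :
  sat_guard c (sat_dur_bounds Pb a) = dur_c_sat Pb a (c (at_start a)).
Proof.
rewrite /sat_guard /sat_dur_bounds /dur_c_sat.
case: (da_lower _) => l s1; case: (da_upper _) => s2 u /=.
by rewrite andbT; case: s1; case: s2.
Qed.

Lemma sat_pre_sat M f v b :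
  matches M f v -> pres Pb b \subset M -> sat_cond v (pre_sat Pb b).
Proof.
move=> [_ _ _ HVP] /subsetP sM; apply/sat_cond_is=> p /sM pM.
by rewrite HVP pM.
Qed.

Lemma sat_eff_sat_invs M f v b :
  matches M f v -> lock_free f b -> sat_cond v (eff_sat_invs Pb b).
Proof.
move=> [_ _ HLP _] Hu; apply/sat_cond_is=> p; rewrite inE => /andP[pna pd].
rewrite HLP big1 // => a _.
by case: eqP => //= /(Hu p a pd pna)/negPf->.
Qed.

Lemma sat_planning M f v : matches M f v -> sat_cond v [:: planning P].
Proof. by case=> HPS _ _ _; rewrite /sat_cond /= HPS. Qed.

Lemma sat_cond_cons v k b :
  sat_cond v (k :: b) = sat_cond v [:: k] && sat_cond v b.
Proof. by rewrite /sat_cond /= andbT. Qed.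

Lemma sat_cond_cat v b1 b2 :
  sat_cond v (b1 ++ b2) = sat_cond v b1 && sat_cond v b2.
Proof. exact: all_cat. Qed.

Lemma set_nth_enum f a l l0 :
  set_nth l0 [seq f b | b <- enum A] (index a (enum A)) l =
  [seq move_to f a l b | b <- enum A].
Proof.
have ia : (index a (enum A) < size (enum A))%N.
  by rewrite index_mem mem_enum.
apply: (@eq_from_nth _ l0) => [|i].
  by rewrite size_set_nth 2!size_map (maxn_idPr ia).
rewrite size_set_nth size_map (maxn_idPr ia) => ltin.
rewrite nth_set_nth /= (nth_map a) // (nth_map a) // /move_to.
case: (i =P _) => [->|ni]; first by rewrite nth_index ?mem_enum ?eqxx.
case: eqP => // E; case: ni; by rewrite -E index_uniq ?enum_uniq.
Qed.

(** Common core of the five edges of an action automaton: what remains for each is its condition,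
    its guard and the preservation of [matches]. *)
Lemma reachable_edge M M' f c a e :
  List.In e (ta_edges (action_automaton Pb eps a)) -> f a = src e ->
  (forall v, matches M f v -> sat_cond v (ed_cond e)) ->
  sat_guard c (ed_guard e) ->
  (forall v, matches M f v ->
     matches M' (move_to f a (tgt e)) (apply_updates (ed_upd e) v)) ->
  reachable M f c ->
  reachable M' (move_to f a (tgt e)) (apply_resets (ed_reset e) c).
Proof.
move=> He Hsrc Hcond Hguard Hupd [v [c' [Hr Hm Hc]]].
exists (apply_updates (ed_upd e) v), (apply_resets (ed_reset e) c').
split; [|exact: Hupd|by move=> h; rewrite /apply_resets Hc].
apply: (run_rcons Hr).
have ia : onth (enum A) (index a (enum A)) = Some a.
  have /onthP[i Hi] : a \in enum A by rewrite mem_enum.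
  have lti : (i < size (enum A))%N by rewrite -onthTE Hi.
  suff -> : index a (enum A) = i by [].
  by rewrite -{1}(onth_nth a a _ _ Hi) index_uniq ?enum_uniq.
rewrite /conf -(set_nth_enum _ _ _ (src e)).
(* The successor accounts for the main automaton at position 0. *)
apply: (@step_internal _ _ _ N _ v c' (index a (enum A)).+1
          (action_automaton Pb eps a) e) => //=.
- by rewrite onth_map ia.
- by rewrite onth_map ia /= Hsrc.
- exact: Hcond.
- by rewrite (sat_guard_ext _ Hc).
Qed.

Lemma apply_snap_VP M f v h e p : matches M f v ->
  apply_updates (with_aa e (prop_effs Pb h)) v (VP p) =
  (p \in apply_snap M h)%:R.
Proof.
move=> [_ _ _ HVP]; rewrite /apply_updates /= !inE.
case: (p \in adds Pb h) => /=; first by rewrite orbT.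
by case: (p \in dels Pb h) => //=; rewrite HVP orbF.
Qed.

(** Serves [se] and [ee']: neither end of these edges is [running], so the [lp] counters keep their
    values. *)
Lemma matches_prop_effs M f v h e a l : matches M f v ->
  f a != running -> l != running ->
  eval v e = v (AA P) - (f a != inactive)%:R + (l != inactive)%:R ->
  matches (apply_snap M h) (move_to f a l)
    (apply_updates (with_aa e (prop_effs Pb h)) v).
Proof.
move=> Hm Hf Hl Hev; split; last by move=> p; exact: apply_snap_VP Hm.
- by case: Hm.
- rewrite (sum_move_to (fun l _ => (l != inactive)%:R)).
  by case: Hm Hev => _ <- _ _ <-.
- move=> p; rewrite (sum_move_to
    (fun l a => ((l == running) && (p \in over_all Pb a))%:R)).
  rewrite (negPf Hf) (negPf Hl) subr0 addr0.
  by case: Hm => _ _ HLP _; exact: HLP.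
Qed.

(** Serves [se'] and [ee]: both ends of these edges are active locations, so [aa] keeps its
    value. *)
Lemma matches_update_lp M f v (ex : var P -> expr (var P)) a l :
  matches M f v -> f a != inactive -> l != inactive ->
  (forall p, p \in over_all Pb a ->
     eval v (ex (LP p)) =
     v (LP p) - (f a == running)%:R + (l == running)%:R) ->
  matches M (move_to f a l) (apply_updates (update_lp Pb ex a) v).
Proof.
move=> [HPS HAA HLP HVP] Hf Hl Hev; split=> //.
- rewrite (sum_move_to (fun l _ => (l != inactive)%:R)) Hf Hl.
  by rewrite subrK -HAA.
- move=> p; rewrite (sum_move_to
    (fun l a => ((l == running) && (p \in over_all Pb a))%:R)) -HLP.
  rewrite /apply_updates /=; case: ifP => pa; first by rewrite Hev ?andbT.
  by rewrite !andbF subr0 addr0.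
Qed.

Lemma matches_move M f v a l : matches M f v ->
  f a != inactive -> l != inactive -> f a != running -> l != running ->
  matches M (move_to f a l) (apply_updates (@no_updates P) v).
Proof.
move=> [HPS HAA HLP HVP] Hf Hl Hf' Hl'; split=> //.
- rewrite (sum_move_to (fun l _ => (l != inactive)%:R)) Hf Hl.
  by rewrite subrK -HAA.
- move=> p; rewrite (sum_move_to
    (fun l a => ((l == running) && (p \in over_all Pb a))%:R)) -HLP.
  by rewrite (negPf Hf') (negPf Hl') subr0 addr0.
Qed.

(** * The five edges of an action automaton *)

Lemma reachable_se M f c a :
  f a = inactive -> pres Pb (at_start a) \subset M ->
  lock_free f (at_start a) -> mutex_clear c (at_start a) ->
  reachable M f c ->
  reachable (apply_snap M (at_start a)) (move_to f a starting)
    (apply_resets [set at_start a] c).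
Proof.
move=> Hf Hp Hu Hc; apply: (@reachable_edge _ _ _ _ _ (se Pb eps a)) => //=.
- by left.
- move=> v Hm; rewrite sat_cond_cons sat_cond_cat (sat_planning Hm).
  by rewrite (sat_pre_sat Hm) // (sat_eff_sat_invs Hm).
- exact: sat_mutex_guards.
- move=> v Hm; apply: matches_prop_effs; rewrite ?Hf //=.
  by rewrite subr0.
Qed.

Lemma reachable_se' M f c a :
  f a = starting -> over_all Pb a \subset M -> reachable M f c ->
  reachable M (move_to f a running) c.
Proof.
move=> Hf Hp Hr.
have := @reachable_edge M M f c a (se' Pb a).
move=> /(_ _ Hf _ _ _ Hr) H.
(* The edge resets nothing, but resetting [set0] is the identity only pointwise. *)
apply: (reachable_ext (erefl _) (fun=> erefl _) _ (H _ _ _ _)) => //=.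
- by move=> h; rewrite /apply_resets inE.
- by right; left.
- move=> v Hm; rewrite sat_cond_cons (sat_planning Hm) /=.
  apply/sat_cond_is => p /(subsetP Hp) pM.
  by case: Hm => _ _ _ ->; rewrite pM.
- move=> v Hm; apply: matches_update_lp; rewrite ?Hf //= => p _.
  by rewrite subr0.
Qed.

Lemma reachable_ee M f c a :
  f a = running -> mutex_clear c (at_end a) ->
  dur_c_sat Pb a (c (at_start a)) -> reachable M f c ->
  reachable M (move_to f a ending) (apply_resets [set at_end a] c).
Proof.
move=> Hf Hc Hd; apply: (@reachable_edge _ _ _ _ _ (ee Pb eps a)) => //=.
- by do 2!right; left.
- by move=> v /sat_planning.
- by rewrite sat_guard_cat sat_mutex_guards // sat_dur_boundsE.
- move=> v Hm; apply: matches_update_lp; rewrite ?Hf //= => p _.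
  by rewrite addr0.
Qed.

Lemma reachable_ie M f c a :
  f a = starting -> mutex_clear c (at_end a) ->
  dur_c_sat Pb a (c (at_start a)) -> reachable M f c ->
  reachable M (move_to f a ending) (apply_resets [set at_end a] c).
Proof.
move=> Hf Hc Hd; apply: (@reachable_edge _ _ _ _ _ (ie Pb eps a)) => //=.
- by do 4!right; left.
- by move=> v /sat_planning.
- by rewrite sat_guard_cat sat_mutex_guards // sat_dur_boundsE.
- by move=> v Hm; apply: matches_move; rewrite ?Hf.
Qed.

Lemma reachable_ee' M f c a :
  f a = ending -> pres Pb (at_end a) \subset M -> lock_free f (at_end a) ->
  reachable M f c ->
  reachable (apply_snap M (at_end a)) (move_to f a inactive) c.
Proof.
move=> Hf Hp Hu Hr.
have := @reachable_edge M (apply_snap M (at_end a)) f c a (ee' Pb a).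
move=> /(_ _ Hf _ _ _ Hr) H.
apply: (reachable_ext (erefl _) (fun=> erefl _) _ (H _ _ _ _)) => //=.
- by move=> h; rewrite /apply_resets inE.
- by do 3!right; left.
- move=> v Hm; rewrite sat_cond_cons sat_cond_cat (sat_planning Hm).
  by rewrite (sat_pre_sat Hm) // (sat_eff_sat_invs Hm).
- move=> v Hm; apply: matches_prop_effs; rewrite ?Hf //=.
  by rewrite addr0.
Qed.

(** The locations between happening time points: none is [starting] or [ending], the urgent ones, so
    time may pass. *)
Definition resting (B : {set A}) a : location :=
  if a \in B then running else inactive.

Lemma reachable_delay M B c delta :
  0 <= delta -> reachable M (resting B) c ->
  reachable M (resting B) (fun h => c h + delta).
Proof.
move=> d0 [v [c' [Hr Hm Hc]]]; exists v, (fun h => c' h + delta).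
split=> // [|h]; last by rewrite Hc.
apply: (run_rcons Hr); apply: step_delay => // -[|i] T l /=.
  by case=> <- [<-].
rewrite !onth_map; case: (onth _ i) => //= a [<-] [<-].
by rewrite /resting; case: ifP.
Qed.

Lemma reachable_init : reachable (pb_init Pb) (resting set0) (fun=> 0).
Proof.
exists (apply_updates (ed_upd (e1M Pb)) (fun=> 0)),
       (apply_resets set0 (fun=> 0)).
split=> [||h]; last by rewrite /apply_resets inE.
- apply: (run_rcons (run_nil _ _)).
  have := @step_internal _ _ _ N (cf_locs (initial_config N)) (fun=> 0)
    (fun=> 0) 0 (main_automaton Pb) (e1M Pb) erefl.
  rewrite /initial_config /conf /=.
  have -> : [seq ta_init T | T <- [seq action_automaton Pb eps a | a <- enum A]]
    = [seq resting set0 a | a <- enum A].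
    by rewrite -map_comp; apply: eq_map => a; rewrite /resting inE.
  by apply=> //; left.
- split=> //.
  + by rewrite big1 // => a _; rewrite /resting inE.
  + by move=> p; rewrite big1 // => a _; rewrite /resting inE.
  + by move=> p; rewrite /apply_updates /=; case: ifP.
Qed.

Lemma reachable_goal M c :
  pb_goal Pb \subset M -> reachable M (resting set0) c ->
  EF N (@main_in_goal P A).
Proof.
move=> /subsetP sG [v [c' [Hr [HPS HAA HLP HVP] _]]].
exists (conf goal_M (resting set0) (apply_updates (ed_upd (e2M Pb)) v)
          (apply_resets set0 c')); split=> //.
apply: (run_rcons Hr).
apply: (@step_internal _ _ _ N _ v c' 0 (main_automaton Pb) (e2M Pb)) => //.
  by right; left.
rewrite sat_cond_cons /=; apply/andP; split.
  by rewrite /sat_cond /= HAA big1 // => a _; rewrite /resting inE.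
by apply/sat_cond_is => p /sG; rewrite HVP => ->.
Qed.

End Network.

(** * The run at a single happening time point *)

Section TimePoint.

Variables (P A : finType) (Pb : problem P A) (eps : rat).
Variables (M : {set P}) (c0 : snap A -> rat).
Variables (H : {set snap A}) (B : {set A}).

Implicit Types (a : A) (h : snap A) (S : {set snap A}) (X Y : {set A}).

(** An intermediate state at the time point, as a function of the set of snap actions already
    applied: this hides their order. *)
Definition after S : {set P} :=
  (M :\: \bigcup_(h in S) dels Pb h) :|: \bigcup_(h in S) adds Pb h.

Definition still_running : {set A} :=
  [set a | (at_end a \notin H) && ((a \in B) || (at_start a \in H))].

Definition snaps X Y : {set snap A} :=
  [set h | match h with inl a => a \in X | inr a => a \in Y end].

Hypothesis mutex_free : {in H &, forall g h, ~~ mutex Pb g h}.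
Hypothesis pres_ok : {in H, forall h, pres Pb h \subset M}.
Hypothesis clocks_ok : {in H, forall h, mutex_clear Pb eps c0 h}.
Hypothesis start_idle : forall a, at_start a \in H -> a \notin B.
Hypothesis end_active :
  forall a, at_end a \in H -> at_start a \notin H -> a \in B.
Hypothesis dur_active : forall a, at_end a \in H -> at_start a \notin H ->
  dur_c_sat Pb a (c0 (at_start a)).
Hypothesis dur_instant :
  forall a, at_end a \in H -> at_start a \in H -> dur_c_sat Pb a 0.
Hypothesis invs_ok :
  {in still_running, forall a, over_all Pb a \subset after H}.

Lemma after0 : after set0 = M.
Proof. by rewrite /after !big_set0 setD0 setU0. Qed.

Lemma mutex_free_disjoint g h p : g \in H -> h \in H -> g != h ->
  ((p \in pres Pb g) && ((p \in adds Pb h) || (p \in dels Pb h)) = false) *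
  ((p \in adds Pb g) && (p \in dels Pb h) = false).
Proof.
move=> gH hH gh; have := mutex_free gH hH.
rewrite /mutex gh /= negb_or !negbK.
move=> /andP[/eqP/setP/(_ p) h1 /eqP/setP/(_ p)].
by move: h1; rewrite !inE.
Qed.

(** The two sides could differ only at a proposition that [h] deletes without adding and that some
    other [g] in [S] adds; then [g] and [h] would be mutex. *)
Lemma after_snap S h :
  S \subset H -> h \in H -> apply_snap Pb (after S) h = after (h |: S).
Proof.
move=> /subsetP sSH hH; rewrite /after !bigcup_setU !big_set1.
apply/setP=> p; rewrite !inE !negb_or.
case pa: (p \in adds Pb h) => /=; first by rewrite !orbT.
rewrite orbF; case pd: (p \in dels Pb h) => //=.
apply/esym/negP => /bigcupP[g gS pg].
have gh : g != h by apply: contraTneq pg => ->; rewrite pa.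
by have := (mutex_free_disjoint p (sSH _ gS) hH gh).2; rewrite pg pd.
Qed.

(** No other snap action of [H] deletes a precondition of [h]; [h] itself may do so, hence
    [h \notin S]. *)
Lemma pres_after S h :
  S \subset H -> h \in H -> h \notin S -> pres Pb h \subset after S.
Proof.
move=> /subsetP sSH hH hS; apply/subsetP=> p ph.
rewrite !inE (subsetP (pres_ok hH)) // andbT; apply/orP; left.
apply/bigcupP=> -[g gS pg].
have hg : h != g by apply: contraNneq hS => ->.
have := (mutex_free_disjoint p hH (sSH _ gS) hg).1.
by rewrite ph pg orbT.
Qed.

(** The clocks already reset at this time point belong to [H], and the mutex guards of [h] read none
    of these. *)
Lemma mutex_clear_resets S h :
  S \subset H -> h \in H -> mutex_clear Pb eps (apply_resets S c0) h.
Proof.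
move=> /subsetP sSH hH g hg; rewrite /apply_resets ifN.
  exact: clocks_ok hg.
by apply: contraL hg => /sSH; apply: mutex_free.
Qed.

(** An invariant of an action that goes on holds in [after H]. If [h] deletes it without adding it,
    another member of [H] adds it and is mutex with [h]. *)
Lemma lock_free_still f h : h \in H ->
  (forall a, f a = running -> a \in still_running) -> lock_free Pb f h.
Proof.
move=> hH sf p a pd pa /sf /invs_ok /subsetP oa; apply/negP=> /oa.
rewrite !inE => /orP[/andP[/bigcupP[]]|/bigcupP[g gH pg]]; first by exists h.
have gh : g != h by apply: contraTneq pg => ->.
by have := (mutex_free_disjoint p gH hH gh).2; rewrite pg pd.
Qed.

Lemma apply_resetsU S S' (c : snap A -> rat) h :
  apply_resets S (apply_resets S' c) h = apply_resets (S :|: S') c h.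
Proof. by rewrite /apply_resets inE; do 2!case: (_ \in _). Qed.

Lemma snapsUl a X Y : snaps (a |: X) Y = at_start a |: snaps X Y.
Proof. by apply/setP=> -[b|b]; rewrite !inE. Qed.

Lemma snapsUr a X Y : snaps X (a |: Y) = at_end a |: snaps X Y.
Proof. by apply/setP=> -[b|b]; rewrite !inE. Qed.

Let starts : {set A} := [set a | at_start a \in H].
Let ends : {set A} := [set a | at_end a \in H].

Lemma snaps_sub X Y :
  X \subset starts -> Y \subset ends -> snaps X Y \subset H.
Proof.
move=> /subsetP sX /subsetP sY; apply/subsetP=> -[a|a]; rewrite !inE.
  by move=> /sX; rewrite inE.
by move=> /sY; rewrite inE.
Qed.

(* [X1], ..., [X5] are the actions that have already taken their edges [ee], [se],
   [ie], [ee'], [se'] at this time point. *)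
Let loc (X1 X2 X3 X4 X5 : {set A}) a : location :=
  if a \in X5 then running
  else if a \in X4 then inactive
  else if a \in X3 then ending
  else if a \in X2 then starting
  else if a \in X1 then ending
  else resting B a.

(** Effects come from [se] and [ee'], resets from [se], [ee] and [ie]: an end snap action resets its
    clock before it takes effect. *)
Let phase X1 X2 X3 X4 X5 : Prop :=
  reachable Pb eps (after (snaps X2 X4)) (loc X1 X2 X3 X4 X5)
    (apply_resets (snaps X2 (X1 :|: X3)) c0).

Lemma snaps0 : snaps set0 set0 = set0.
Proof. by apply/setP=> -[b|b]; rewrite !inE. Qed.

(** * The five rounds of edges at the time point *)

Lemma phase_ee :
  phase set0 set0 set0 set0 set0 ->
  phase (ends :\: starts) set0 set0 set0 set0.
Proof.
move=> Q0; apply: (@set_loop_ind _ (fun Y => phase Y set0 set0 set0 set0)) => //.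
move=> Y a sY; rewrite !inE => /andP[aS aE] aY.
have sYE : Y \subset ends by apply: subset_trans sY (subsetDl _ _).
have sH : snaps set0 Y \subset H by apply: snaps_sub; rewrite ?sub0set.
rewrite /phase !setU0 => /(@reachable_ee _ _ _ _ _ _ _ a) Q.
apply: (reachable_ext (erefl _) _ _ (Q _ _ _)).
- by move=> b; rewrite /move_to /loc !inE; case: eqP => // ->.
- by move=> h; rewrite apply_resetsU snapsUr.
- by rewrite /loc !inE (negPf aY) /resting end_active.
- exact: mutex_clear_resets.
(* Only end clocks have been reset so far, so the start clock still shows the duration. *)
- by rewrite /apply_resets inE /= inE dur_active.
Qed.

Lemma phase_se (X1 := ends :\: starts) :
  phase X1 set0 set0 set0 set0 -> phase X1 starts set0 set0 set0.
Proof.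
move=> Q0; apply: (@set_loop_ind _ (fun Y => phase X1 Y set0 set0 set0)) => //.
move=> Y a sY aS aY; have aS' : at_start a \in H by rewrite inE in aS.
have sH : snaps Y X1 \subset H by apply: snaps_sub; rewrite ?subsetDl.
have sH0 : snaps Y set0 \subset H by apply: snaps_sub; rewrite ?sub0set.
rewrite /phase !setU0 => /(@reachable_se _ _ _ _ _ _ _ a) Q.
apply: (reachable_ext _ _ _ (Q _ _ _ _)).
- by rewrite after_snap // snapsUl.
- by move=> b; rewrite /move_to /loc !inE; case: eqP => // ->.
- by move=> h; rewrite apply_resetsU snapsUl.
- by rewrite /loc !inE (negPf aY) aS' /= /resting (negPf (start_idle aS')).
- by apply: pres_after; rewrite // !inE.
(* An action in [B] does not start now, so if it ends it has already left [running] by [ee]. *)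
- apply: lock_free_still => // b; rewrite /loc !inE.
  case: ifP => // _; case: ifP => // /negbT; rewrite negb_and negbK /resting.
  case: ifP => // bB; have := contraL (@start_idle b) bB => /negPf->.
  by rewrite /= => ->.
- exact: mutex_clear_resets.
Qed.

Lemma phase_ie (X1 := ends :\: starts) :
  phase X1 starts set0 set0 set0 ->
  phase X1 starts (ends :&: starts) set0 set0.
Proof.
move=> Q0; apply: (@set_loop_ind _ (fun Y => phase X1 starts Y set0 set0)) => //.
move=> Y a sY; rewrite !inE => /andP[aE aS] aY.
have sYE : Y \subset ends by apply: subset_trans sY (subsetIl _ _).
have sH : snaps starts (X1 :|: Y) \subset H.
  by apply: snaps_sub; rewrite // subUset subsetDl.
rewrite /phase => /(@reachable_ie _ _ _ _ _ _ _ a) Q.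
apply: (reachable_ext (erefl _) _ _ (Q _ _ _)).
- by move=> b; rewrite /move_to /loc !inE; case: eqP => // ->.
- by move=> h; rewrite apply_resetsU setUCA snapsUr.
- by rewrite /loc !inE (negPf aY) aS.
- exact: mutex_clear_resets.
(* The start clock was reset by [se] at this very time point and shows 0. *)
- by rewrite /apply_resets inE /= inE aS dur_instant.
Qed.

Lemma phase_ee' (X1 := ends :\: starts) (X3 := ends :&: starts) :
  phase X1 starts X3 set0 set0 -> phase X1 starts X3 ends set0.
Proof.
move=> Q0; apply: (@set_loop_ind _ (fun Y => phase X1 starts X3 Y set0)) => //.
move=> Y a sY aE aY; have aE' : at_end a \in H by rewrite inE in aE.
have sH : snaps starts Y \subset H by apply: snaps_sub.
rewrite /phase => /(@reachable_ee' _ _ _ _ _ _ _ a) Q.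
apply: (reachable_ext _ _ _ (Q _ _ _)).
- by rewrite after_snap // snapsUr.
- by move=> b; rewrite /move_to /loc !inE; case: eqP => // ->.
- by [].
(* The action reached [ending] by [ie] or by [ee], according to whether it also starts now. *)
- by rewrite /loc !inE (negPf aY) aE' /=; case: (_ \in _).
- by apply: pres_after; rewrite // !inE.
- apply: lock_free_still => // b; rewrite /loc !inE /resting.
  case: (b \in Y) => //; case: (at_start b \in H); rewrite ?andbF ?andbT.
    by case: ifP.
  case: (at_end b \in H) => //=.
  by case: (b \in B).
Qed.

Lemma phase_se' (X1 := ends :\: starts) (X3 := ends :&: starts) :
  phase X1 starts X3 ends set0 -> phase X1 starts X3 ends (starts :\: ends).
Proof.
move=> Q0; apply: (@set_loop_ind _ (fun Y => phase X1 starts X3 ends Y)) => //.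
move=> Y a sY; rewrite !inE => /andP[aE aS] aY.
rewrite /phase => /(@reachable_se' _ _ _ _ _ _ _ a) Q.
(* All of [H] has taken effect, so the invariants are checked in [after H]. *)
have eH : snaps starts ends = H by apply/setP=> -[b|b]; rewrite !inE.
apply: (reachable_ext _ _ _ (Q _ _)) => //.
- by move=> b; rewrite /move_to /loc !inE; case: eqP => // ->.
- by rewrite /loc !inE (negPf aY) (negPf aE) aS.
- by rewrite eH; apply: invs_ok; rewrite inE aE aS orbT.
Qed.

Lemma reachable_happening :
  reachable Pb eps M (resting B) c0 ->
  reachable Pb eps (after H) (resting still_running) (apply_resets H c0).
Proof.
move=> Q0; have Q : phase set0 set0 set0 set0 set0.
  apply: reachable_ext Q0.
  - by rewrite snaps0 after0.
  - by move=> a; rewrite /loc !inE.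
  - by move=> h; rewrite setU0 snaps0 /apply_resets inE.
move/phase_ee/phase_se/phase_ie/phase_ee'/phase_se': Q.
apply: reachable_ext.
- by congr after; apply/setP=> -[b|b]; rewrite !inE.
- move=> a; rewrite /loc /resting !inE.
  case: (boolP (at_end a \in H)) => //= aE.
  by case: (boolP (at_start a \in H)) => //= aS; rewrite ?orbF ?orbT.
- move=> h; congr (if _ then _ else _); case: h => b; rewrite !inE //.
  by case: (at_end b \in H); case: (at_start b \in H).
Qed.

End TimePoint.

(** * Decidable equality and membership for plan entries *)

Section EntryEqType.

Variable A : finType.

Definition entry_code (e : entry A) := (e_act e, e_time e, e_dur e).
Definition entry_decode (x : A * rat * rat) := Entry x.1.1 x.1.2 x.2.

Lemma entry_codeK : cancel entry_code entry_decode.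
Proof. by case. Qed.

HB.instance Definition _ := Equality.copy (entry A) (can_type entry_codeK).

End EntryEqType.

Lemma mem_In (T : eqType) (x : T) (s : seq T) : x \in s -> List.In x s.
Proof.
elim: s => //= y s IH; rewrite inE => /orP[/eqP->|/IH]; [by left|by right].
Qed.

Lemma mem_bigcup_seq (I : eqType) (T : finType) (s : seq I) (Q : pred I)
    (F : I -> {set T}) p :
  (p \in \bigcup_(x <- s | Q x) F x) = has (fun x => Q x && (p \in F x)) s.
Proof.
elim: s => [|x s IH]; first by rewrite big_nil inE.
by rewrite big_cons /= -IH; case: (Q x); rewrite ?inE.
Qed.

(** * Active actions and clock values along the plan *)

Section Plan.

Variables (P A : finType) (Pb : problem P A) (eps : rat) (pi : plan A).

Implicit Types (a : A) (h : snap A) (e : entry A) (t : rat).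

(** The interval is the one of [Invs]; [active_after] includes the start and excludes the end
    instead. Entries of duration zero count in neither. *)
Definition active_before t : {set A} :=
  [set a | has (fun e => (e_act e == a) &&
                         (e_time e < t <= e_time e + e_dur e)) pi].
Definition active_after t : {set A} :=
  [set a | has (fun e => (e_act e == a) &&
                         (e_time e <= t < e_time e + e_dur e)) pi].
Definition happening_at t : {set snap A} := [set h | (t, h) \in happenings pi].

(* A clock is either still counting from the initial delay [eps + 1], which
   passes every mutex guard, or from an earlier happening of its snap action. *)
Definition clocks_at t (c : snap A -> rat) : Prop :=
  (forall h, eps + 1 <= c h \/
     exists s, [/\ (s, h) \in happenings pi, s < t & c h = t - s]) /\
  (forall e, e \in pi -> e_time e < t <= e_time e + e_dur e ->
     c (at_start (e_act e)) = t - e_time e).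

Lemma active_beforeP t a :
  reflect (exists e, [/\ e \in pi, e_act e = a, e_time e < t
                       & t <= e_time e + e_dur e])
          (a \in active_before t).
Proof.
rewrite inE; apply: (iffP hasP) => [[e epi /andP[/eqP ea /andP[t1 t2]]]|].
  by exists e.
by move=> [e [epi ea t1 t2]]; exists e; rewrite // ea eqxx t1.
Qed.

Lemma active_afterP t a :
  reflect (exists e, [/\ e \in pi, e_act e = a, e_time e <= t
                       & t < e_time e + e_dur e])
          (a \in active_after t).
Proof.
rewrite inE; apply: (iffP hasP) => [[e epi /andP[/eqP ea /andP[t1 t2]]]|].
  by exists e.
by move=> [e [epi ea t1 t2]]; exists e; rewrite // ea eqxx t1.
Qed.

Lemma start_happensP t a :
  reflect (exists e, [/\ e \in pi, e_act e = a & e_time e = t])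
          (at_start a \in happening_at t).
Proof.
rewrite inE mem_cat; apply: (iffP orP).
  by case=> /mapP[e epi] // [-> ->]; exists e.
by move=> [e [epi <- <-]]; left; apply/mapP; exists e.
Qed.

Lemma end_happensP t a :
  reflect (exists e, [/\ e \in pi, e_act e = a & e_time e + e_dur e = t])
          (at_end a \in happening_at t).
Proof.
rewrite inE mem_cat; apply: (iffP orP).
  by case=> /mapP[e epi] // [-> ->]; exists e.
by move=> [e [epi <- <-]]; right; apply/mapP; exists e.
Qed.

Lemma htps_happening t h : (t, h) \in happenings pi -> t \in htps pi.
Proof.
by move=> th; rewrite mem_sort mem_undup; apply/mapP; exists (t, h).
Qed.

Lemma htps_start e : e \in pi -> e_time e \in htps pi.
Proof.
move=> epi; apply: (@htps_happening _ (at_start (e_act e))).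
have : at_start (e_act e) \in happening_at (e_time e).
  by apply/start_happensP; exists e.
by rewrite inE.
Qed.

Lemma htps_end e : e \in pi -> e_time e + e_dur e \in htps pi.
Proof.
move=> epi; apply: (@htps_happening _ (at_end (e_act e))).
have : at_end (e_act e) \in happening_at (e_time e + e_dur e).
  by apply/end_happensP; exists e.
by rewrite inE.
Qed.

Lemma htps_sorted : sorted <%R (htps pi).
Proof. by rewrite lt_sorted_uniq_le sort_uniq undup_uniq sort_le_sorted. Qed.

Local Notation tau i := (nth 0 (htps pi) i).

Lemma tau_lt i j : (i < size (htps pi))%N -> (j < size (htps pi))%N ->
  (tau i < tau j) = (i < j)%N.
Proof. by move=> *; rewrite (lt_sorted_ltn_nth _ htps_sorted). Qed.

Lemma htps_first t : t \in htps pi -> tau 0 <= t.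
Proof.
move=> ht; have lt := ht; rewrite -index_mem in lt.
rewrite -(nth_index 0 ht) leNgt tau_lt //.
exact: leq_ltn_trans lt.
Qed.

(** No happening lies strictly between consecutive time points. *)
Lemma htps_gap i t : (i.+1 < size (htps pi))%N -> t \in htps pi ->
  (t < tau i.+1) = (t <= tau i).
Proof.
move=> li ht; have lt := ht; rewrite -index_mem in lt.
rewrite -(nth_index 0 ht) tau_lt // leNgt tau_lt //; last exact: ltnW.
by rewrite -leqNgt.
Qed.

Lemma htps_last i t : i.+1 = size (htps pi) -> t \in htps pi -> t <= tau i.
Proof.
move=> li ht; have lt := ht; rewrite -index_mem in lt.
rewrite -(nth_index 0 ht) leNgt tau_lt //; last by rewrite -li.
by rewrite -leqNgt -ltnS li.
Qed.

Hypothesis eps_ge0 : 0 <= eps.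
Hypothesis pi_dur :
  forall e, List.In e pi -> dur_c_sat Pb (e_act e) (e_dur e) /\ 0 <= e_dur e.
Hypothesis pi_mutex : forall s t (a b : snap A),
  (s, a) \in happenings pi -> (t, b) \in happenings pi ->
  a <> b -> mutex Pb a b -> 0 < `|t - s| /\ eps <= `|t - s|.
Hypothesis pi_nso : no_self_overlap pi.

(** The contrapositive of [no_self_overlap], with entries in place of their positions in the
    plan. *)
Lemma overlap_eq x y : x \in pi -> y \in pi -> e_act x = e_act y ->
  e_time x <= e_time y -> e_time y <= e_time x + e_dur x -> x = y.
Proof.
move=> /onthP[i xi] /onthP[j yj] exy t1 t2.
have [ij|/eqP ij] := eqVneq i j.
  by move: yj; rewrite -ij xi => -[].
by case: (pi_nso ij xi yj _ exy); rewrite t1.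
Qed.

(** Simultaneous happenings are at distance 0, which the strict bound excludes even for
    [eps = 0]. *)
Lemma not_mutex_at t :
  {in happening_at t &, forall g h, ~~ mutex Pb g h}.
Proof.
move=> g h; rewrite !inE => tg th; apply/negP => mgh.
have gh : g <> h by move: mgh; rewrite /mutex => /andP[/eqP].
by have [] := pi_mutex tg th gh mgh; rewrite subrr normr0 ltxx.
Qed.

(** A clock that shows [t - s] for an earlier happening at [s] passes the guards exactly by the
    separation that validity demands. *)
Lemma clocks_at_clear t c :
  clocks_at t c -> {in happening_at t, forall h, mutex_clear Pb eps c h}.
Proof.
move=> [Hc _] h; rewrite inE => th g mhg.
have [ge1|[s [sg st ->]]] := Hc g.
  by move: eps_ge0 ge1 => h1 h2; split; lra.
have hg : h <> g by move: mhg; rewrite /mutex => /andP[/eqP].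
have := pi_mutex th sg hg mhg.
by rewrite distrC ger0_norm // subr_ge0 ltW.
Qed.

Lemma still_running_at t :
  still_running (happening_at t) (active_before t) = active_after t.
Proof.
apply/setP=> a; rewrite [LHS]inE; apply/idP/active_afterP.
  move=> /andP[/end_happensP aE /orP[/active_beforeP|/start_happensP]].
    move=> [e [epi ea t1 t2]]; exists e; split=> //; first exact: ltW.
    rewrite lt_neqAle t2 andbT; apply/eqP=> tE; apply: aE.
    by exists e.
  move=> [e [epi ea t1]]; exists e; split=> //; first by rewrite t1.
  have [_ d0] := pi_dur (mem_In epi).
  rewrite lt_neqAle -{2}t1 lerDl d0 andbT; apply/eqP=> tE; apply: aE.
  by exists e.
move=> [e [epi ea t1 t2]]; apply/andP; split.
  (* An entry [x] of the same action that ends at [t] would overlap [e], whichever of the two starts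
     first. *)
  apply/end_happensP=> -[x [xpi xa tx]].
  have [_ d0] := pi_dur (mem_In xpi).
  have [le|/ltW le] := leP (e_time x) (e_time e).
    have ex : x = e by apply: overlap_eq; rewrite ?xa ?ea ?tx.
    by move: t2; rewrite -ex tx ltxx.
  have ex : e = x by apply: overlap_eq; rewrite ?xa ?ea //; lra.
  by move: t2; rewrite ex tx ltxx.
move: t1; rewrite le_eqVlt => /orP[/eqP t1|t1].
  by apply/orP; right; apply/start_happensP; exists e.
by apply/orP; left; apply/active_beforeP; exists e; split=> //; exact: ltW.
Qed.

(** Overlap includes the right endpoint, so an action cannot start again even at the moment when an
    earlier occurrence ends. *)
Lemma start_not_active t a :
  at_start a \in happening_at t -> a \notin active_before t.
Proof.
move=> /start_happensP[x [xpi xa xt]].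
apply/active_beforeP=> -[e [epi ea t1 t2]].
have ex : e = x by apply: overlap_eq; rewrite ?xa ?ea ?xt //; exact: ltW.
by move: t1; rewrite ex xt ltxx.
Qed.

Lemma end_not_start t a :
  at_end a \in happening_at t -> at_start a \notin happening_at t ->
  exists e, [/\ e \in pi, e_act e = a, e_time e < t & e_time e + e_dur e = t].
Proof.
move=> /end_happensP[e [epi ea et]] /start_happensP aS.
exists e; split=> //; have [_ d0] := pi_dur (mem_In epi).
rewrite lt_neqAle -{2}et lerDl d0 andbT; apply/eqP=> tE; apply: aS.
by exists e.
Qed.

Lemma after_happening_at t (M : {set P}) :
  after Pb M (happening_at t) = (M :\: Dels Pb pi t) :|: Adds Pb pi t.
Proof.
have eqU (F : snap A -> {set P}) :
    \bigcup_(h in happening_at t) F h =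
    \bigcup_(x <- happenings pi | x.1 == t) F x.2.
  apply/setP=> p; rewrite [RHS]mem_bigcup_seq; apply/bigcupP/hasP.
    move=> [h]; rewrite inE => th ph; exists (t, h) => //=.
    by rewrite eqxx.
  by move=> [[s h] sh /= /andP[/eqP st ph]]; exists h; rewrite // inE -st.
by rewrite /after !eqU.
Qed.

Lemma reachable_happening_at t (M M' : {set P}) c :
  (forall h, (t, h) \in happenings pi -> pres Pb h \subset M) ->
  M' = (M :\: Dels Pb pi t) :|: Adds Pb pi t ->
  {in active_after t, forall a, over_all Pb a \subset M'} ->
  clocks_at t c -> reachable Pb eps M (resting (active_before t)) c ->
  reachable Pb eps M' (resting (active_after t))
    (apply_resets (happening_at t) c).
Proof.
move=> Hpre -> Hinv Hc; rewrite -after_happening_at -still_running_at.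
apply: reachable_happening.
- exact: not_mutex_at.
- by move=> h; rewrite inE; apply: Hpre.
- exact: clocks_at_clear.
- exact: start_not_active.
- move=> a aE aS; have [e [epi ea t1 t2]] := end_not_start aE aS.
  by apply/active_beforeP; exists e; rewrite t2.
- move=> a aE aS; have [e [epi ea t1 t2]] := end_not_start aE aS.
  rewrite -ea (Hc.2 _ epi) ?t1 ?t2 //=.
  rewrite -t2 addrAC subrr add0r.
  by case: (pi_dur (mem_In epi)).
- move=> a /end_happensP[e [epi ea te]] /start_happensP[x [xpi xa tx]].
  have [Hd d0] := pi_dur (mem_In epi).
  (* The entry that ends at [t] and the one that starts at [t] are the same, hence of duration
     zero. *)
  have ex : e = x by apply: overlap_eq; rewrite ?xa ?ea //; lra.
  move: Hd; rewrite ea; suff -> : e_dur e = 0 by [].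
  by move: te; rewrite -tx ex; lra.
- by rewrite still_running_at after_happening_at.
Qed.

Lemma active_before_first : active_before (tau 0) = set0.
Proof.
apply/setP=> a; rewrite [RHS]inE; apply/negP => /active_beforeP[e [epi _ t1 _]].
by have := htps_first (htps_start epi); rewrite leNgt t1.
Qed.

Lemma active_after_last i :
  i.+1 = size (htps pi) -> active_after (tau i) = set0.
Proof.
move=> li; apply/setP=> a; rewrite [RHS]inE.
apply/negP => /active_afterP[e [epi _ _ t2]].
by have := htps_last li (htps_end epi); rewrite leNgt t2.
Qed.

(** No entry starts or ends strictly between the two time points. *)
Lemma active_between i : (i.+1 < size (htps pi))%N ->
  active_after (tau i) = active_before (tau i.+1).
Proof.
move=> li; apply/setP=> a.
apply/active_afterP/active_beforeP => -[e [epi ea t1 t2]]; exists e.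
  split=> //; first by rewrite htps_gap ?htps_start.
  by rewrite leNgt htps_gap ?htps_end // -ltNge.
split=> //; first by rewrite -htps_gap ?htps_start.
by rewrite ltNge -htps_gap ?htps_end // -leNgt.
Qed.

Lemma clocks_at_next i c : (i.+1 < size (htps pi))%N -> clocks_at (tau i) c ->
  clocks_at (tau i.+1)
    (fun h => apply_resets (happening_at (tau i)) c h + (tau i.+1 - tau i)).
Proof.
move=> li [Hc Hd].
have lt : tau i < tau i.+1 by rewrite tau_lt // ltnW.
split=> [h|e epi /andP[t1 t2]]; rewrite /apply_resets.
  case: ifP => [|_].
    by rewrite inE => th; right; exists (tau i); rewrite add0r.
  have [ge1|[s [sh st ->]]] := Hc h; first by left; lra.
  by right; exists s; split=> //; lra.
move: t1; rewrite htps_gap ?htps_start // le_eqVlt => /orP[/eqP t1|t1].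
  rewrite ifT; first by rewrite add0r t1.
  by apply/start_happensP; exists e.
rewrite ifN; first by rewrite Hd // ?t1 //=; lra.
(* A second start of the action at [tau i] would overlap [e], so the start clock of [e] is not
   reset. *)
apply/start_happensP=> -[x [xpi xa tx]].
have ex : e = x by apply: overlap_eq; rewrite ?xa //; lra.
by move: t1; rewrite ex tx ltxx.
Qed.

(** * Induction over the happening time points *)

Variable M : seq {set P}.
Hypothesis M_valid : valid_state_seq Pb pi M.
Hypothesis M_init : nth set0 M 0 = pb_init Pb.
Hypothesis M_goal : pb_goal Pb \subset last set0 M.

(** The actions active after [tau i] are those whose invariants validity requires at [tau i.+1];
    after the last time point there are none. *)
Lemma invs_after i : (i < size (htps pi))%N ->
  {in active_after (tau i), forall a, over_all Pb a \subset nth set0 M i.+1}.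
Proof.
rewrite leq_eqVlt => /orP[/eqP li|li] a.
  by rewrite active_after_last // inE.
rewrite active_between // => /active_beforeP[e [epi <- t1 t2]].
have [_ _] := M_valid.2 _ li; apply: subset_trans.
apply/subsetP=> p pe; rewrite mem_bigcup_seq; apply/hasP.
by exists e; rewrite // t1 t2.
Qed.

Lemma reachable_after i c : (i < size (htps pi))%N -> clocks_at (tau i) c ->
  reachable Pb eps (nth set0 M i) (resting (active_before (tau i))) c ->
  reachable Pb eps (nth set0 M i.+1) (resting (active_after (tau i)))
    (apply_resets (happening_at (tau i)) c).
Proof.
move=> li; have [Hp HM _] := M_valid.2 _ li.
by apply: reachable_happening_at => //; apply: invs_after.
Qed.

Lemma reachable_before i : (i < size (htps pi))%N ->
  exists c, clocks_at (tau i) c /\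
    reachable Pb eps (nth set0 M i) (resting (active_before (tau i))) c.
Proof.
elim: i => [|i IH] li.
  (* The initial delay does not depend on [tau 0]: only differences of times matter, and no entry
     starts before [tau 0]. *)
  exists (fun=> 0 + (eps + 1)); split.
    split=> [h|e epi /andP[t1 _]]; first by left; rewrite add0r.
    by have := htps_first (htps_start epi); rewrite leNgt t1.
  rewrite M_init active_before_first.
  by apply: reachable_delay (reachable_init _ _); rewrite addr_ge0.
have [c [Hc Hr]] := IH (ltnW li).
eexists; split; first exact: clocks_at_next li Hc.
rewrite -active_between //; apply: reachable_delay.
  by rewrite subr_ge0 ltW // tau_lt // ltnW.
exact: reachable_after (ltnW li) Hc Hr.
Qed.

Lemma encoding_reaches_goal : EF (encoding Pb eps) (@main_in_goal P A).
Proof.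
have sG : pb_goal Pb \subset nth set0 M (size (htps pi)).
  by move: M_goal; rewrite -nth_last M_valid.1.
(* Without happenings the goal already holds initially, and the main automaton moves on at once. *)
case Es: (size (htps pi)) sG => [|i] sG.
  by apply: (reachable_goal sG); rewrite M_init; apply: reachable_init.
have li : (i < size (htps pi))%N by rewrite Es.
have [c [Hc Hr]] := reachable_before li.
have := reachable_after li Hc Hr.
by rewrite (active_after_last (esym Es)); apply: reachable_goal sG.
Qed.

End Plan.

Theorem theorem1 (P A : finType) (Pb : problem P A) (eps : rat)
    (eps_ge0 : 0 <= eps) (pi : plan A) (pi_valid : valid Pb eps pi)
    (pi_nso : no_self_overlap pi) :
  EF (encoding Pb eps) (@main_in_goal P A).
Proof.
case: pi_valid => -[M [M_valid M_init M_goal]] pi_dur pi_mutex.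
exact: (encoding_reaches_goal eps_ge0 pi_dur pi_mutex pi_nso M_valid).
Qed.
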